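(* Let $R$ be a unique factorization domain and let $f\in R[x_1,\dots,x_n]$ be multiaffine in $x_1,\dots,x_n$ with coefficient of $x_1\cdots x_n$ equal to one. Then $f=\det(\mathrm{diag}(x_1,\dots,x_n)+A)$ for some $n\times n$ matrix $A$ with entries in $R$ if and only if there are polynomials $g_{ij}$ ($i\neq j\in[n]$) such that for every $i\neq j\in[n]$, $\Delta_{ij}(f)=g_{ij}\cdot g_{ji}$, where (a) $g_{ij}\in R[x_k:k\neq i,j]$ is multiaffine in $x_1,\dots,x_n$, and (b) for every $k\in[n]\setminus\{i,j\}$, $\mathrm{res}_{x_k}(g_{ij},f)=g_{ik}g_{kj}$. In this case, we can take $g_{ij}$ to be the $(i,j)$th entry of the adjugate matrix $(\mathrm{diag}(x_1,\dots,x_n)+A)^{\mathrm{adj}}$.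
   Context: $[n]=\{1,\dots,n\}$. Multiaffine means of degree at most $1$ in each variable. The Rayleigh difference is $\Delta_{ij}(f)=\frac{\partial f}{\partial x_i}\frac{\partial f}{\partial x_j}-f\,\frac{\partial^2f}{\partial x_i\partial x_j}$. For polynomials $g,h$ of degree at most one in $x_k$, $\mathrm{res}_{x_k}(g,h)=(g|_{x_k=0})\cdot\frac{\partial h}{\partial x_k}-(h|_{x_k=0})\cdot\frac{\partial g}{\partial x_k}$. *)

(* Defs.v *)
From HB Require Import structures.
From mathcomp Require Import all_boot all_algebra.
From mathcomp Require Export mpoly.

Set Implicit Arguments.
Unset Strict Implicit.
Unset Printing Implicit Defensive.

Import GRing.Theory.
Local Open Scope ring_scope.

Section UniqueFactorization.
Variable R : idomainType.

Definition irreducible_elt (p : R) : Prop :=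
  [/\ p != 0, p \isn't a GRing.unit &
      forall a b : R, p = a * b -> a \is a GRing.unit \/ b \is a GRing.unit].

Definition associated (a b : R) : Prop :=
  exists2 u : R, u \is a GRing.unit & b = u * a.

Definition is_ufd : Prop :=
  (forall a : R, a != 0 -> a \isn't a GRing.unit ->
     exists2 s : seq R, {in s, forall p, irreducible_elt p} &
                        a = \prod_(p <- s) p)
  /\
  (forall s t : seq R,
     {in s, forall p, irreducible_elt p} ->
     {in t, forall p, irreducible_elt p} ->
     \prod_(p <- s) p = \prod_(p <- t) p ->
     exists2 t' : seq R, perm_eq t t' &
       size s = size t' /\
       forall i : nat, (i < size s)%N -> associated s`_i t'`_i).

End UniqueFactorization.

Section Multiaffine.
Variables (R : idomainType) (n : nat).
Implicit Types (f g h p : {mpoly R[n]}) (i j k : 'I_n).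

(* degree of p in the variable 'X_i, with the convention degvar i 0 = 0 *)
Definition degvar i p : nat := \max_(m <- msupp p) (m i : nat).

Definition multiaffine p : Prop := forall i, (degvar i p <= 1)%N.

Definition subst0 k p : {mpoly R[n]} :=
  p \mPo [tuple (if i == k then 0 else 'X_i) | i < n].

Definition rayleigh i j f : {mpoly R[n]} :=
  f^`M(i) * f^`M(j) - f * f^`M(i)^`M(j).

(* Used only when g and h have degree at most one in 'X_k, where it is the
   usual resultant up to sign. *)
Definition res k g h : {mpoly R[n]} :=
  subst0 k g * h^`M(k) - subst0 k h * g^`M(k).

Definition diagX_plus (A : 'M[R]_n) : 'M[{mpoly R[n]}]_n :=
  diag_mx (\row_i 'X_i) + map_mx (@mpolyC n R) A.

(* The diagonal values g i i are unconstrained: the family of the theorem is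
   indexed by pairs of distinct indices. *)
Definition rayleigh_factorization f (g : 'I_n -> 'I_n -> {mpoly R[n]}) : Prop :=
  forall i j, i != j ->
    [/\ rayleigh i j f = g i j * g j i,
        [/\ degvar i (g i j) = 0%N, degvar j (g i j) = 0%N &
            multiaffine (g i j)] &
        forall k, k != i -> k != j -> res k (g i j) f = g i k * g k j].

End Multiaffine.

(* Main.v *)
Require Import Defs.
From HB Require Import structures.
From mathcomp Require Import all_boot all_algebra.
From mathcomp Require Import ring zify.

Set Implicit Arguments.
Unset Strict Implicit.
Unset Printing Implicit Defensive.

Import GRing.Theory.
Local Open Scope ring_scope.

(**
Write M = diag(x_1, ..., x_n) + A and let G be the matrix with diagonal entries
G_ii = df/dx_i and off-diagonal entries g_ij.  The idea is that G / f should be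
the inverse (the resolvent) of M, and that this can be read off from a
differential equation: since dM/dx_k is the matrix unit E_kk, an inverse H of M
satisfies dH/dx_k = - H E_kk H.  With H = G / f and denominators cleared, this
is the equation called [resolvent_eq] below,

  f (dG_ij/dx_k) = (df/dx_k) G_ij - G_ik G_kj    for all i, j, k.

For i = j and k distinct from i it says that the Rayleigh difference of f at
i, k is G_ik G_ki.  For i, j, k distinct it is the resultant condition, because
res_{x_k}(g, h) = g (dh/dx_k) - h (dg/dx_k) when g and h have degree at most
one in x_k.  For i, j distinct and k one of them it only says that g_ij is free
of x_k.  So the Rayleigh factorizations of f are the solutions of this equation
whose entries have the right degrees ([rayleigh_resolvent],
[rayleigh_of_resolvent]).

If f = det M then G = adj M is a solution: differentiate adj M * M = f I and
multiply on the right by adj M ([resolvent_eq_adj]).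

Conversely, the equation integrates.  Over the fraction field it says that
d(H^-1)/dx_k = E_kk, so that H(x+t)^-1 - H(x)^-1 = diag(t), which without
inverses reads

  f(x+t) G(x) - f(x) G(x+t) = G(x) diag(t) G(x+t).

This is stated coefficient by coefficient in t, a squarefree monomial in t
giving an iterated derivative, in [mderivs_resolvent]; the induction only uses
that f can be cancelled.  The monomial prod_(k != j) t_k singles out column j
of G.  It calls for such high derivatives that, by multiaffinity, the one of f
is x_j plus a constant and those of the entries of G are constants.  What
remains is column j of G M = f I for M = diag(x) + A, where the entries of A
are these constants up to sign, hence lie in R ([resolvent_mul]).

Finally D = det M is f: multiplying G M = f I by adj M shows that f and D have
the same logarithmic derivatives, and both have coefficient one at
x_1 ... x_n ([logderiv_inj]).
*)

(** * Degree in one variable *)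

Section DegreeInOneVariable.
Variables (R : idomainType) (n : nat).
Implicit Types (p q : {mpoly R[n]}) (i j k : 'I_n).

Lemma degvar_leP k p d :
  reflect {in msupp p, forall m : 'X_{1..n}, (m k <= d)%N} (degvar k p <= d)%N.
Proof.
by apply: (iffP (bigmax_leqP_seq _ _ _ _)) => h m hm;
  [apply: h | move=> _; apply: h].
Qed.

Lemma degvar_supp k p m : m \in msupp p -> (m k <= degvar k p)%N.
Proof. by move: m; apply/degvar_leP. Qed.

Lemma degvarN k p : degvar k (- p) = degvar k p.
Proof. exact: perm_big (msuppN p). Qed.

Lemma degvarD_le k p q d :
  (degvar k p <= d)%N -> (degvar k q <= d)%N -> (degvar k (p + q) <= d)%N.
Proof.
move=> /degvar_leP hp /degvar_leP hq; apply/degvar_leP => m.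
by move/msuppD_le; rewrite mem_cat => /orP[/hp|/hq].
Qed.

Lemma degvarM_le k p q d e :
  (degvar k p <= d)%N -> (degvar k q <= e)%N -> (degvar k (p * q) <= d + e)%N.
Proof.
move=> /degvar_leP hp /degvar_leP hq; apply/degvar_leP => m.
move/msuppM_le/allpairsP => [[m1 m2] /= [/hp h1 /hq h2 ->]].
by rewrite mnmDE leq_add.
Qed.

Lemma degvarC k (c : R) : degvar k c%:MP = 0%N.
Proof.
apply/eqP; rewrite -leqn0; apply/degvar_leP => m; rewrite msuppC.
by case: eqP => // _ /[!inE] /eqP ->; rewrite mnm0E.
Qed.

Lemma degvarX_le k i : (degvar k ('X_i : {mpoly R[n]}) <= (i == k))%N.
Proof. by apply/degvar_leP => m /mem_msuppXP <-; rewrite mnm1E. Qed.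

Lemma degvar_sum_le k I (r : seq I) (P : pred I) (F : I -> {mpoly R[n]}) d :
  (forall a, P a -> degvar k (F a) <= d)%N ->
  (degvar k (\sum_(a <- r | P a) F a) <= d)%N.
Proof.
move=> hF; apply: (big_ind (fun p => degvar k p <= d)%N) => //.
- by rewrite -mpolyC0 degvarC.
- by move=> p q; apply: degvarD_le.
Qed.

Lemma degvar_prod_le k (I : finType) (F : I -> {mpoly R[n]})
    (d : I -> nat) :
  (forall a, degvar k (F a) <= d a)%N ->
  (degvar k (\prod_a F a) <= \sum_a d a)%N.
Proof.
move=> hF; apply: (big_ind2 (fun p e => degvar k p <= e)%N) => //.
- by rewrite -mpolyC1 degvarC.
- by move=> p e q e'; apply: degvarM_le.
Qed.

(** Each term of the Leibniz expansion takes one entry from each row. *)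
Lemma degvar_det_le k m (B : 'M[{mpoly R[n]}]_m) (d : 'I_m -> nat) :
  (forall a b, degvar k (B a b) <= d a)%N ->
  (degvar k (\det B) <= \sum_a d a)%N.
Proof.
move=> hB; apply: degvar_sum_le => s _; rewrite -[leqRHS]add0n.
apply: degvarM_le; last exact: degvar_prod_le.
by rewrite -signr_odd; case: odd; rewrite ?degvarN -mpolyC1 degvarC.
Qed.

Lemma degvar_cofactor_le k m (B : 'M[{mpoly R[n]}]_m) (d : 'I_m -> nat)
    (i j : 'I_m) :
  (forall a b, degvar k (B a b) <= d a)%N ->
  (degvar k (cofactor B i j) <= \sum_(a | a != i) d a)%N.
Proof.
move=> hB; rewrite -[leqRHS]add0n; apply: degvarM_le.
  by rewrite -signr_odd; case: odd; rewrite ?degvarN -mpolyC1 degvarC.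
have -> : (\sum_(a | a != i) d a = \sum_a d (lift i a))%N.
  have e : (\sum_a d a = d i + \sum_a d (lift i a))%N by rewrite (bigD1_ord i).
  by rewrite (bigD1 i) //= in e; apply: addnI e.
by apply: degvar_det_le => a b; rewrite !mxE.
Qed.

Lemma degvar_mderiv_le k i p d :
  (degvar k p <= d)%N -> (degvar k p^`M(i) <= d - (i == k))%N.
Proof.
move=> /degvar_leP hp; apply/degvar_leP => m.
rewrite mcoeff_msupp mcoeff_deriv => nz.
have /hp : (m + U_(i))%MM \in msupp p.
  by rewrite mcoeff_msupp; apply: contraNneq nz => ->; rewrite mul0rn.
by rewrite mnmDE mnm1E; case: (i == k); lia.
Qed.

Lemma mderiv_degvar0 k p : degvar k p = 0%N -> p^`M(k) = 0.
Proof.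
move=> hp; apply/mpolyP => m; rewrite mcoeff_deriv mcoeff0.
rewrite memN_msupp_eq0 ?mul0rn //; apply/negP => /(degvar_supp k).
by rewrite hp mnmDE mnm1E eqxx; lia.
Qed.

(** The bound on the degree is what makes this true in positive
    characteristic. *)
Lemma degvar0_mderiv k p :
  (degvar k p <= 1)%N -> p^`M(k) = 0 -> degvar k p = 0%N.
Proof.
move=> h1 h0; apply/eqP; rewrite -leqn0; apply/degvar_leP => m hm.
have := degvar_supp k hm; case E : (m k) => [|[|?]]; try lia.
have: (p^`M(k))@_(m - U_(k)) = 0 by rewrite h0 mcoeff0.
rewrite mcoeff_deriv submK ?lep1mP ?E // mnmBE mnm1E eqxx E mulr1n.
by move=> e _; move: hm; rewrite mcoeff_msupp e eqxx.
Qed.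

Lemma degvar0_const p : (forall k, degvar k p = 0%N) -> p = (p@_0%MM)%:MP.
Proof.
move=> h; apply/mpolyP => m; rewrite mcoeffC.
have [->|ne] := eqVneq m 0%MM; first by rewrite mulr1.
rewrite mulr0 memN_msupp_eq0 //; apply: contra ne => hm.
by apply/eqP/mnmP => k; have := degvar_supp k hm; rewrite h mnm0E leqn0 => /eqP.
Qed.

Lemma subst0_mderiv k p :
  (degvar k p <= 1)%N -> p = subst0 k p + 'X_k * p^`M(k).
Proof.
move=> /degvar_leP hp; rewrite {1}(mpolyE p) /subst0 comp_mpolyEX.
rewrite [X in X^`M(k)]mpolyE raddf_sum mulr_sumr -big_split /=.
rewrite big_seq [RHS]big_seq; apply: eq_bigr => m /hp hm.
rewrite mderivZ mderivX -scalerAr -scalerDr; congr (_ *: _).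
rewrite comp_mpolyX (bigD1 k) //= tnth_mktuple eqxx expr0n.
case E : (m k) hm => [|[|//]] _ /=; last first.
  rewrite mul0r add0r scale1r -mpolyXD addmC submK // lep1mP E //.
rewrite scale0r mulr0 addr0 mul1r [LHS]mpolyXE_id (bigD1 k) //= E expr0 mul1r.
by apply: eq_bigr => i /negPf ne; rewrite tnth_mktuple ne.
Qed.

(** In this form the resultant is the numerator of the derivative of - p / q,
    which is how it enters the differential equation. *)
Lemma resE k p q : (degvar k p <= 1)%N -> (degvar k q <= 1)%N ->
  res k p q = p * q^`M(k) - q * p^`M(k).
Proof.
move=> hp hq.
have := subst0_mderiv hp; have := subst0_mderiv hq; rewrite /res.
by move: (subst0 k p) (subst0 k q) p^`M(k) q^`M(k) => a b a' b' -> ->; ring.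
Qed.

End DegreeInOneVariable.

(** * Iterated derivatives *)

Section IteratedDerivatives.
Variables (R : idomainType) (n : nat).
Implicit Types (k l : 'I_n) (p f : {mpoly R[n]}) (s : seq 'I_n).

Definition mderivs s p := foldr (@mderiv n R) p s.

Lemma perm_mderivs s1 s2 p : perm_eq s1 s2 -> mderivs s1 p = mderivs s2 p.
Proof. exact: mderiv_perm. Qed.

Lemma degvar_mderivs_le k s p d :
  (degvar k p <= d)%N -> (degvar k (mderivs s p) <= d - (k \in s))%N.
Proof.
move=> hp; elim: s => [|l s IH] /=; first by rewrite subn0.
rewrite in_cons eq_sym; have [->|ne] := eqVneq l k.
  have := degvar_mderiv_le k IH; rewrite eqxx => /leq_trans; apply.
  by rewrite leq_sub2r // leq_subr.
by have := degvar_mderiv_le l IH; rewrite (negPf ne) subn0.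
Qed.

Lemma mderivs_degvar0 k s p : k \in s -> degvar k p = 0%N -> mderivs s p = 0.
Proof.
move=> ks hp; rewrite (perm_mderivs p (perm_to_rem ks)) /=.
apply: mderiv_degvar0; apply/eqP; rewrite -leqn0.
by rewrite -[X in (_ <= X)%N](sub0n (k \in rem k s)) degvar_mderivs_le // hp.
Qed.

(** No integer factors appear, since each variable is differentiated once and
    m is free of it. *)
Lemma mcoeff_mderivs s p (m : 'X_{1..n}) :
  uniq s -> {in s, forall k, m k = 0%N} ->
  (mderivs s p)@_m = p@_(m + \sum_(k <- s) U_(k))%MM.
Proof.
elim: s m => [m _ _|l s IH m /= /andP[ls us] hm].
  by rewrite big_nil addm0.
rewrite mcoeff_deriv (hm l (mem_head _ _)) mulr1n IH // => [|k ks]; last first.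
  rewrite mnmDE mnm1E hm ?inE ?ks ?orbT //.
  by case: eqP ls => // -> /negP[].
by rewrite big_cons addmA.
Qed.

(** By multiaffinity the iterated derivative is a constant.  It stands in for
    the leading coefficient below because it fits the differential equation. *)
Lemma mderivs_enum1 f : multiaffine f -> f@_[multinom 1%N | i < n] = 1 ->
  mderivs (enum 'I_n) f = 1.
Proof.
move=> hf hlead; rewrite (degvar0_const (p := mderivs _ f)) => [|k]; last first.
  apply/eqP; rewrite -leqn0; have := degvar_mderivs_le (enum 'I_n) (hf k).
  by rewrite mem_enum.
rewrite mcoeff_mderivs ?enum_uniq // => [|k _]; last by rewrite mnm0E.
rewrite add0m -mpolyC1 -hlead; congr (_@__)%:MP; apply/mnmP => i.
rewrite mnm_sumE mnmE big_enum (bigD1 i) //= mnm1E eqxx big1 // => j ne.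
by rewrite mnm1E (negPf ne).
Qed.

Lemma mderivs_eq1_neq0 s p : mderivs s p = 1 -> p != 0.
Proof.
move=> p1; apply: contra_eq_neq p1 => ->; rewrite eq_sym.
suff -> : mderivs s 0 = 0 by rewrite oner_eq0.
by elim: s => //= l s ->; rewrite mderiv0.
Qed.

(** From f_S p = f p_S, where a subscript S stands for an iterated derivative,
    the same for S + l follows by differentiating in x_l and then using both
    equalities to exchange f_S p_l for f_l p_S.  For S the set of all
    variables the equality is p = f. *)
Lemma logderiv_inj f p : (forall k, f^`M(k) * p = f * p^`M(k)) ->
  mderivs (enum 'I_n) f = 1 -> mderivs (enum 'I_n) p = 1 -> f = p.
Proof.
move=> h f1 p1; have f0 := mderivs_eq1_neq0 f1; have p0 := mderivs_eq1_neq0 p1.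
suff e s : mderivs s f * p = f * mderivs s p.
  by have := e (enum 'I_n); rewrite f1 p1 mul1r mulr1.
elim: s => [|l s IH] //=.
have := congr1 (@mderiv n R l) IH; rewrite !mderivM.
suff -> : mderivs s f * p^`M(l) = f^`M(l) * mderivs s p.
  by rewrite addrC => /addrI.
apply: (mulfI f0); apply: (mulfI p0).
ring: IH (h l).
Qed.

End IteratedDerivatives.

(** * The determinant and adjugate of diag(x) + A *)

Section DeterminantOfAffineMatrix.
Variables (R : idomainType) (n : nat).
Implicit Types (i j k l : 'I_n) (s : seq 'I_n).
Implicit Types (A : 'M[R]_n) (B : 'M[{mpoly R[n]}]_n).

Lemma degvar_nat k m : degvar k (m%:R : {mpoly R[n]}) = 0%N.
Proof. by rewrite -mpolyC1 -mpolyCMn degvarC. Qed.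

(** Expand along row k: the variable x_k occurs in no other row, so the
    cofactors of that row are constants for the derivation. *)
Lemma mderiv_det k B :
  (forall a b, degvar k (B a b) <= (a == k))%N ->
  (forall b, (B k b)^`M(k) = (k == b)%:R) ->
  (\det B)^`M(k) = cofactor B k k.
Proof.
move=> hdeg hrow; rewrite (expand_det_row _ k) raddf_sum /= (bigD1 k) //=.
have dcof b : (cofactor B k b)^`M(k) = 0.
  apply: mderiv_degvar0; apply/eqP; rewrite -leqn0.
  have := degvar_cofactor_le k b hdeg.
  by rewrite [X in (_ <= X)%N]big1 // => a /negPf ->.
move: (cofactor B k) dcof => c dcof.
rewrite mderivM dcof hrow eqxx mul1r mulr0 addr0 big1 ?addr0 // => b ne.
by rewrite mderivM dcof hrow eq_sym (negPf ne) mul0r mulr0 addr0.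
Qed.

Lemma diagX_plusE A i j : diagX_plus A i j = 'X_i *+ (i == j) + (A i j)%:MP.
Proof. by rewrite !mxE. Qed.

Lemma mderiv_diagX_plus A i j k :
  (diagX_plus A i j)^`M(k) = ((i == k) && (j == k))%:R.
Proof.
rewrite diagX_plusE mderivD mderivC addr0 mderivMn mderivX mnm1E.
have [->|ne] := eqVneq i k; last by rewrite scale0r mul0rn.
by rewrite -{1}[U_(k)%MM]add0m addmK scale1r mpolyX0 eq_sym.
Qed.

Lemma degvar_diagX_plus A i j k :
  (degvar k (diagX_plus A i j) <= (i == k) && (j == k))%N.
Proof.
rewrite diagX_plusE; apply: degvarD_le; last by rewrite degvarC.
have [->|ne] := eqVneq i j; last by rewrite mulr0n -mpolyC0 degvarC.
by rewrite andbb degvarX_le.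
Qed.

Lemma degvar_diagX_row A i j k : (degvar k (diagX_plus A i j) <= (i == k))%N.
Proof.
apply: leq_trans (degvar_diagX_plus A i j k) _.
by case: (i == k); case: (j == k).
Qed.

Lemma mderiv_det_diagX A k :
  (\det (diagX_plus A))^`M(k) = (\adj (diagX_plus A)) k k.
Proof.
rewrite mderiv_det => [|a b|b]; first by rewrite mxE.
  exact: degvar_diagX_row.
by rewrite mderiv_diagX_plus eqxx eq_sym.
Qed.

(** Differentiating in x_l removes row and column l; keeping the size fixed by
    putting a row of the identity instead makes the induction uniform. *)
Lemma mderivs_det_diagX A s : uniq s ->
  mderivs s (\det (diagX_plus A)) =
  \det (\matrix_(i, j) (if i \in s then (i == j)%:R else diagX_plus A i j)).
Proof.
elim: s => [_|l s IH /= /andP[ls us]].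
  by congr (\det _); apply/matrixP => i j; rewrite !mxE.
rewrite IH // mderiv_det => [|a b|b]; last 2 first.
- rewrite mxE; case: ifP => _; first by rewrite degvar_nat.
  exact: degvar_diagX_row.
- by rewrite mxE (negPf ls) mderiv_diagX_plus eqxx eq_sym.
rewrite (expand_det_row _ l) (bigD1 l) //= mxE mem_head eqxx mul1r.
rewrite big1 ?addr0 => [|j ne]; last first.
  by rewrite mxE mem_head eq_sym (negPf ne) mul0r.
congr (_ * \det _); apply/matrixP => a b; rewrite !mxE in_cons.
by rewrite [lift l a == l]eq_sym (negPf (neq_lift _ _)).
Qed.

Lemma mderivs_det_diagX1 A :
  mderivs (enum 'I_n) (\det (diagX_plus A)) = 1.
Proof.
rewrite mderivs_det_diagX ?enum_uniq // -[RHS](det1 _ n); congr (\det _).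
by apply/matrixP => i j; rewrite !mxE mem_enum.
Qed.

Lemma degvar_adj_row A i j k :
  (degvar k ((\adj (diagX_plus A)) i j) <= (k != j))%N.
Proof.
rewrite mxE.
have := degvar_cofactor_le j i (fun a b => degvar_diagX_row A a b k).
move/leq_trans; apply; have [<-|ne] := eqVneq k j.
  by rewrite big1 // => a /negPf ->.
by rewrite (bigD1 k) //= eqxx big1 // => a /andP[_ /negPf ->].
Qed.

Lemma trmx_diagX_plus A : (diagX_plus A)^T = diagX_plus A^T.
Proof.
apply/matrixP => i j; rewrite mxE !diagX_plusE mxE.
by have [->|] := eqVneq i j; rewrite ?mulr0n.
Qed.

Lemma degvar_adj_col A i j k :
  (degvar k ((\adj (diagX_plus A)) i j) <= (k != i))%N.
Proof.
by have := degvar_adj_row A^T j i k; rewrite -trmx_diagX_plus -trmx_adj mxE.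
Qed.

(** The equation dH/dx_k = - H E_kk H for H = G / f, multiplied by f^2. *)
Definition resolvent_eq (f : {mpoly R[n]}) (G : 'M[{mpoly R[n]}]_n) : Prop :=
  forall i j k, f * (G i j)^`M(k) = f^`M(k) * G i j - G i k * G k j.

(** Differentiating adj M * M = D I gives
    (d adj M) * M = (dD) I - adj M * E_kk, and M * adj M = D I. *)
Lemma resolvent_eq_adj A :
  resolvent_eq (\det (diagX_plus A)) (\adj (diagX_plus A)).
Proof.
move=> i j k; set M := diagX_plus A; set D := \det M.
pose d (B : 'M[{mpoly R[n]}]_n) := map_mx (mderiv k) B.
have dMul B C : d (B *m C) = d B *m C + B *m d C.
  apply/matrixP => a b; rewrite !mxE raddf_sum -big_split /=.
  by apply: eq_bigr => c _; rewrite !mxE mderivM.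
have dM : d M = delta_mx k k.
  by apply/matrixP => a b; rewrite mxE mderiv_diagX_plus mxE.
have e : d (\adj M) *m M = (D^`M(k))%:M - \adj M *m delta_mx k k.
  apply/eqP; rewrite eq_sym subr_eq -dM -dMul mul_adj_mx; apply/eqP.
  by apply/matrixP => a b; rewrite !mxE mderivMn.
have {e} := congr1 (fun B => (B *m \adj M) i j) e.
rewrite -mulmxA mul_mx_adj mulmxBl mul_scalar_mx mul_mx_scalar.
(* E_kk is the product of the k-th unit column and the k-th unit row. *)
move: (\adj M) => N; rewrite -(mul_delta_mx (0 : 'I_1)) mulmxA -colE.
rewrite -mulmxA -rowE => e; move: e.
by rewrite !mxE big_ord1 !mxE.
Qed.

End DeterminantOfAffineMatrix.

(** * Integrating the differential equation *)

Section Resolvent.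
Variables (R : idomainType) (n : nat).
Implicit Types (i j k l : 'I_n) (f : {mpoly R[n]}) (s : seq 'I_n).
Implicit Types (G : 'M[{mpoly R[n]}]_n).

(** This is the coefficient of prod_(k in s) t_k in
    f(x+t) G(x) - f(x) G(x+t) = G(x) diag(t) G(x+t), obtained without division
    by adding the variables of s one at a time. *)
Lemma mderivs_resolvent f G s : f != 0 -> resolvent_eq f G -> uniq s ->
  forall i j, mderivs s f * G i j - f * mderivs s (G i j) =
    \sum_(k <- s) G i k * mderivs (rem k s) (G k j).
Proof.
move=> f0 hG; elim: s => [_ i j|l s IH /= /andP[ls us] i j].
  by rewrite big_nil subrr.
rewrite big_cons /= eqxx.
under eq_big_seq => k ks.
  have -> : (l == k) = false by apply: contraNF ls => /eqP ->.
  rewrite /=; over.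
(* S1 is the part of the sum that the goal needs; differentiating the induction
   hypothesis produces it together with S2, and f S2 is reduced by the
   differential equation to the induction hypotheses in rows i and l. *)
pose T k := mderivs (rem k s) (G k j).
pose S1 := \sum_(k <- s) G i k * (T k)^`M(l).
pose S2 := \sum_(k <- s) (G i k)^`M(l) * T k.
have eS1 : (mderivs s f)^`M(l) * G i j + mderivs s f * (G i j)^`M(l)
    - (f^`M(l) * mderivs s (G i j) + f * (mderivs s (G i j))^`M(l)) = S2 + S1.
  have := congr1 (@mderiv n R l) (IH us i j).
  rewrite mderivB !mderivM raddf_sum /= => ->.
  by rewrite -big_split; apply: eq_bigr => k _; rewrite mderivM.
have eS2 : f * S2 = f^`M(l) * (mderivs s f * G i j - f * mderivs s (G i j))
    - G i l * (mderivs s f * G l j - f * mderivs s (G l j)).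
  rewrite !IH // /S2 !mulr_sumr -sumrB; apply: eq_bigr => k _.
  rewrite [LHS]mulrA hG /T; ring.
have eG := hG i j l.
rewrite -/S1; apply: (mulfI f0).
have -> : S1 = (S2 + S1) - S2 by rewrite [RHS]addrC addKr.
rewrite -eS1; ring: eS2 eG.
Qed.

(** The matrix A with f G^-1 = diag(x) + A.  Away from the diagonal, entry
    (i, j) of adj (diag(x) + A) has - A_ij as coefficient of
    prod_(k != i, j) x_k, whence the sign. *)
Definition resolvent_constant f G : 'M[R]_n :=
  \matrix_(i, j)
    if i == j then (mderivs (rem j (enum 'I_n)) f)@_0%MM
    else - (mderivs (rem i (rem j (enum 'I_n))) (G i j))@_0%MM.

(** Column j of the product is [mderivs_resolvent] for the set of all variables
    but x_j, all the iterated derivatives being computed from the degrees. *)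
Lemma resolvent_mul f G :
  multiaffine f -> mderivs (enum 'I_n) f = 1 -> resolvent_eq f G ->
  (forall i, G i i = f^`M(i)) ->
  (forall i j k, i != j -> degvar k (G i j) <= (k != i) && (k != j))%N ->
  G *m diagX_plus (resolvent_constant f G) = f%:M.
Proof.
move=> hf f1 hG Gd Gdeg; set A := resolvent_constant f G.
have f0 := mderivs_eq1_neq0 f1.
apply/matrixP => i j; pose s := rem j (enum 'I_n).
have us : uniq s by rewrite rem_uniq ?enum_uniq.
have ins k : (k \in s) = (k != j).
  by rewrite mem_rem_uniq ?enum_uniq // !inE mem_enum andbT.
have ps : perm_eq (j :: s) (enum 'I_n).
  by rewrite perm_sym perm_to_rem // mem_enum.
have fs : mderivs s f = 'X_j + (A j j)%:MP.
  have e : mderivs s f - 'X_j = ((mderivs s f - 'X_j)@_0%MM)%:MP.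
    apply: degvar0_const => k.
    have hle : (degvar k (mderivs s f - 'X_j) <= (j == k))%N.
      apply: degvarD_le; last by rewrite degvarN degvarX_le.
      have := degvar_mderivs_le s (hf k); rewrite ins eq_sym.
      by case: eqP.
    have [jk|ne] := eqVneq j k; last first.
      by apply/eqP; rewrite -leqn0; move: hle; rewrite (negPf ne).
    rewrite -jk in hle *; rewrite eqxx in hle.
    (* The derivative vanishes because f has leading coefficient one. *)
    apply: degvar0_mderiv => //.
    rewrite mderivB -[X in X - _]/(mderivs (j :: s) f) (perm_mderivs f ps) f1.
    rewrite mderivX mnm1E eqxx scale1r -{1}[U_(j)%MM]add0m addmK mpolyX0.
    exact: subrr.
  rewrite -[LHS](subrK 'X_j) e addrC mcoeffB mcoeffX mnm1_eq0 subr0.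
  by rewrite mxE eqxx.
have Gs : mderivs s (G i j) = (i == j)%:R.
  have [->|ne] := eqVneq i j; last first.
    apply: (mderivs_degvar0 (k := i)); first by rewrite ins.
    by apply/eqP; rewrite -leqn0; have := Gdeg i j i ne; rewrite eqxx.
  rewrite Gd -f1 -[LHS](foldr_rcons (@mderiv n R) f s j).
  by apply: mderiv_perm; rewrite perm_rcons.
have Gks k : k != j -> mderivs (rem k s) (G k j) = - (A k j)%:MP.
  move=> ne; rewrite mxE (negPf ne) mpolyCN opprK; apply: degvar0_const => l.
  have := degvar_mderivs_le (rem k s) (Gdeg k j l ne).
  rewrite mem_rem_uniq // inE ins.
  by case: (l != k); case: (l != j); rewrite /= ?subn0 leqn0 => /eqP.
have e : ('X_j + (A j j)%:MP) * G i j - f * (i == j)%:R =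
    - \sum_(k | k != j) G i k * (A k j)%:MP.
  rewrite -fs -Gs mderivs_resolvent // {1}/s rem_filter ?enum_uniq //.
  rewrite big_filter big_enum_cond -sumrN; apply: eq_bigr => k ne.
  by rewrite Gks // mulrN.
rewrite !mxE (bigD1 j) //= diagX_plusE eqxx mulr1n.
rewrite (eq_bigr (fun k => G i k * (A k j)%:MP)) => [|k /negPf ne]; last first.
  by rewrite diagX_plusE ne mulr0n add0r.
rewrite -[X in _ + X]opprK -e -mulr_natr; ring.
Qed.

(** G M = f I multiplied by adj M gives D G = f adj M.  On the diagonal this
    says that f and D = det M have the same logarithmic derivatives. *)
Lemma det_of_resolvent f G :
  multiaffine f -> mderivs (enum 'I_n) f = 1 -> resolvent_eq f G ->
  (forall i, G i i = f^`M(i)) ->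
  (forall i j k, i != j -> degvar k (G i j) <= (k != i) && (k != j))%N ->
  f = \det (diagX_plus (resolvent_constant f G)).
Proof.
move=> hf f1 hG Gd Gdeg; have eG := resolvent_mul hf f1 hG Gd Gdeg.
set A := resolvent_constant f G in eG *.
apply: logderiv_inj => [k||] //; last exact: mderivs_det_diagX1.
have := congr1 (fun B => (B *m \adj (diagX_plus A)) k k) eG.
rewrite -mulmxA mul_mx_adj mul_mx_scalar mul_scalar_mx mderiv_det_diagX -Gd.
by rewrite !mxE mulrC.
Qed.

End Resolvent.

(** * Rayleigh factorizations as solutions *)

Section RayleighFactorization.
Variables (R : idomainType) (n : nat).
Implicit Types (f : {mpoly R[n]}) (g : 'I_n -> 'I_n -> {mpoly R[n]}).

Definition rayleigh_matrix f g : 'M[{mpoly R[n]}]_n :=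
  \matrix_(i, j) if i == j then f^`M(i) else g i j.

(** The equation at (i, j, k) is trivial if i = j = k, the Rayleigh condition at
    (i, k) if i = j, a consequence of g_ij being free of x_k if k is one of
    i and j, and the resultant condition otherwise. *)
Lemma rayleigh_resolvent f g : multiaffine f -> rayleigh_factorization f g ->
  resolvent_eq f (rayleigh_matrix f g).
Proof.
move=> hf hg i j k; rewrite !mxE.
have [<-{j}|ij] := eqVneq i j.
  have [->|ik] := eqVneq i k.
    rewrite subrr mderiv_degvar0 ?mulr0 //; apply/eqP; rewrite -leqn0.
    by have := degvar_mderiv_le k (hf k); rewrite eqxx.
  case: (hg i k ik) => <- _ _.
  rewrite /rayleigh; ring.
case: (hg i j ij) => _ [di dj gij] hres.
have [<-{k}|ik] := eqVneq i k.
  by rewrite (negPf ij) mderiv_degvar0 // mulr0 subrr.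
have [->|kj] := eqVneq k j.
  by rewrite mderiv_degvar0 // mulr0 mulrC subrr.
rewrite -hres ?resE // 1?eq_sym //; ring.
Qed.

Lemma rayleigh_matrix_degvar f g i j k : rayleigh_factorization f g -> i != j ->
  (degvar k (rayleigh_matrix f g i j) <= (k != i) && (k != j))%N.
Proof.
move=> hg ij; have [_ [di dj gij] _] := hg i j ij; rewrite mxE (negPf ij).
have [->|ki] := eqVneq k i; first by rewrite di.
by have [->|kj] := eqVneq k j; [rewrite dj | exact: gij].
Qed.

Lemma rayleigh_of_resolvent f (G : 'M[{mpoly R[n]}]_n) :
  multiaffine f -> resolvent_eq f G -> (forall i, G i i = f^`M(i)) ->
  (forall i j k, degvar k (G i j) <= (k != i) && (k != j))%N ->
  rayleigh_factorization f G.
Proof.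
move=> hf hG Gd Gdeg i j ij; have gij : multiaffine (G i j).
  by move=> k; apply: leq_trans (Gdeg i j k) (leq_b1 _).
split=> [||k ki kj].
- have := hG i i j; rewrite !Gd /rayleigh => ->; ring.
- split=> //; apply/eqP; rewrite -leqn0.
    by have := Gdeg i j i; rewrite eqxx.
  by have := Gdeg i j j; rewrite eqxx andbF.
rewrite resE // hG; ring.
Qed.

End RayleighFactorization.

Theorem theorem3p1 (R : idomainType) (hR : is_ufd R) (n : nat)
    (f : {mpoly R[n]}) (hf : multiaffine f)
    (hlead : f@_[multinom 1%N | i < n] = 1) :
  ((exists A : 'M[R]_n, f = \det (diagX_plus A)) <->
   (exists g : 'I_n -> 'I_n -> {mpoly R[n]}, rayleigh_factorization f g))
  /\
  (forall A : 'M[R]_n, f = \det (diagX_plus A) ->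
     rayleigh_factorization f (fun i j => (\adj (diagX_plus A)) i j)).
Proof.
have adjE A : f = \det (diagX_plus A) ->
    rayleigh_factorization f (fun i j => (\adj (diagX_plus A)) i j).
  move=> fE; apply: rayleigh_of_resolvent => //.
  - by rewrite fE; apply: resolvent_eq_adj.
  - by move=> i; rewrite fE mderiv_det_diagX.
  - move=> i j k; have := degvar_adj_row A i j k.
    by case: (k != i) (degvar_adj_col A i j k).
split=> //; split=> [[A fE]|[g hg]].
  by exists (fun i j => (\adj (diagX_plus A)) i j); apply: adjE.
exists (resolvent_constant f (rayleigh_matrix f g)).
apply: det_of_resolvent => //.
- exact: mderivs_enum1.
- exact: rayleigh_resolvent.
- by move=> i; rewrite mxE eqxx.
- by move=> i j k ij; apply: rayleigh_matrix_degvar.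
Qed.
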